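(* \textsc{Broadcast Domination} can be solved in time $d^d n^{O(d)}$ on digraphs of order $n$ and diameter $d$.
   Context: Digraphs are finite and assumed weakly connected. For vertices $u,v$, $d(u,v)$ is the length of a shortest directed path from $u$ to $v$ ($\infty$ if none). The diameter of a digraph is $\max_{u,v} d(u,v)$ (infinite if the digraph is not strongly connected). A dominating broadcast of $D$ is a function $f:V(D)\to\mathbb{N}$ such that for every vertex $v$ there is a vertex $t$ with $f(t)>0$ and $d(t,v)\le f(t)$; its cost is $\sum_v f(v)$. \textsc{Broadcast Domination}: given $D$ and $k$, decide whether $D$ has a dominating broadcast of cost at most $k$. *)

(* Defs.v *)
From mathcomp Require Import all_boot.

Set Implicit Arguments.
Unset Strict Implicit.
Unset Printing Implicit Defensive.

Section Digraph.

(* A digraph on the finite vertex type V is given by its arc relation. *)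
Variables (V : finType) (e : rel V).

Definition weakly_connected : Prop :=
  forall u v : V, connect (fun x y => e x y || e y x) u v.

Definition dipath_of_length (u v : V) (m : nat) : bool :=
  [exists p : m.-tuple V, [&& path e u p, uniq (u :: p) & last u p == v]].

Lemma connect_dipath (u v : V) :
  connect e u v -> exists m, dipath_of_length u v m.
Proof.
case/connectP=> p ep ->; case/shortenP: ep => q eq uq _.
by exists (size q); apply/existsP; exists (in_tuple q); rewrite eq uq /=.
Qed.

(* None stands for an infinite distance, and likewise for the diameter. *)
Definition dist (u v : V) : option nat :=
  if @idP (connect e u v) is ReflectT uv
  then Some (ex_minn (connect_dipath uv)) else None.

Definition diameter : option nat :=
  if [forall u, forall v, isSome (dist u v)]
  then Some (\max_(u : V) \max_(v : V) odflt 0 (dist u v)) else None.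

Definition dominating_broadcast (f : V -> nat) : Prop :=
  forall v : V, exists t : V,
    0 < f t /\ exists2 m : nat, dist t v = Some m & m <= f t.

Definition broadcast_cost (f : V -> nat) : nat := \sum_(v : V) f v.

Definition broadcast_domination (k : nat) : Prop :=
  exists f : V -> nat, dominating_broadcast f /\ broadcast_cost f <= k.

End Digraph.

(* Unit-cost random access machine with registers and a separate memory, both
   indexed by nat and holding natural numbers.  The only arithmetic is addition
   and truncated subtraction: with multiplication at unit cost, running time
   would no longer be polynomially related to Turing machine time. *)
Inductive instr : Type :=
| Const of nat & nat         (* Const r c   : r <- c                       *)
| Add of nat & nat & nat     (* Add r s t   : r <- s + t                   *)
| Sub of nat & nat & nat     (* Sub r s t   : r <- s - t                   *)
| Read of nat & nat          (* Read r s    : r <- memory cell number s    *)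
| Write of nat & nat         (* Write r s   : memory cell number r <- s    *)
| JumpZ of nat & nat         (* JumpZ r l   : go to instruction l if r = 0 *)
| Halt.

Definition program := seq instr.

Record state := State { pc : nat; reg : nat -> nat; mem : nat -> nat }.

(* Leaving the program halts. *)
Definition current (p : program) (s : state) : instr := nth Halt p (pc s).

Definition halted (p : program) (s : state) : bool :=
  if current p s is Halt then true else false.

Definition upd (f : nat -> nat) (a x : nat) : nat -> nat :=
  fun b => if b == a then x else f b.

Definition step (p : program) (s : state) : state :=
  let: State i r m := s in
  match current p s with
  | Const a c   => State i.+1 (upd r a c) m
  | Add a b c   => State i.+1 (upd r a (r b + r c)) m
  | Sub a b c   => State i.+1 (upd r a (r b - r c)) m
  | Read a b    => State i.+1 (upd r a (m (r b))) m
  | Write a b   => State i.+1 r (upd m (r a) (r b))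
  | JumpZ a l   => State (if r a == 0 then l else i.+1) r m
  | Halt        => s
  end.

(* Since a halted state is a fixed point of step, being halted after T steps
   means having stopped within T steps.  The answer is read in register 0. *)
Definition decides_within (p : program) (s : state) (Q : Prop) (T : nat) : Prop :=
  let s' := iter T (step p) s in halted p s' /\ (reg s' 0 = 1 <-> Q).

(* The instance (D, k), with D on vertices 0, ..., n - 1: registers 0 and 1
   hold n and k, and the memory starts with the adjacency matrix of D, row by
   row.  Everything else is 0. *)
Definition instance (n : nat) (e : rel 'I_n) (k : nat) : state :=
  State 0
    (fun r => if r == 0 then n else if r == 1 then k else 0)
    (fun a => [exists i : 'I_n, exists j : 'I_n, (a == i * n + j) && e i j]).

(* Main.v *)
(* Any single vertex dominates with value max(d, 1), where d is the diameter, so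
   an optimal broadcast has cost at most max(d, 1); and a broadcast of cost l is a
   list of l vertices, each counted with multiplicity.  Lists are tried in the
   order of their codes in bijective base n, hence by increasing length, until
   one dominates: fewer than (n + 1)^max(d, 1) lists are tried, each in time
   polynomial in n and its code, and the length of the successful one is the
   optimal cost.  To test a list, give each listed vertex t the power f(t) + 1
   and each other vertex 0, and n times replace the power of v by the maximum
   of itself and the powers of its in-neighbours minus 1: the list dominates
   iff all powers end up positive. *)
Require Import Defs.
From mathcomp Require Import all_boot.
From mathcomp Require Import zify.

Set Implicit Arguments.
Unset Strict Implicit.
Unset Printing Implicit Defensive.

(** * Structured programs *)

Local Notation store := (nat -> nat).

Inductive com :=
| Block of seq instr
| Seq of com & com
| While of nat & com.

(** Reserved for loop control, as the blocks below use only registers up to 19; set to 0, it turns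
    [JumpZ] into an unconditional jump. *)
Definition scratch := 20.

(** Jump targets are absolute, hence the load address [o]. *)
Fixpoint code (o : nat) (c : com) : program :=
  match c with
  | Block b => b
  | Seq c1 c2 => code o c1 ++ code (o + size (code o c1)) c2
  | While a c =>
      JumpZ a (o + size (code o.+1 c) + 3) ::
      code o.+1 c ++ [:: Const scratch 0; JumpZ scratch o]
  end.

Definition straight (a : instr) : bool :=
  match a with JumpZ _ _ | Halt => false | _ => true end.

Fixpoint exec (b : seq instr) (r m : store) : store * store :=
  match b with
  | Const a c :: b   => exec b (upd r a c) m
  | Add a a' c :: b  => exec b (upd r a (r a' + r c)) m
  | Defs.Sub a a' c :: b => exec b (upd r a (r a' - r c)) m
  | Read a a' :: b   => exec b (upd r a (m (r a'))) m
  | Write a a' :: b  => exec b r (upd m (r a) (r a'))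
  | _ => (r, m)
  end.

Definition placed (p : program) (o : nat) (c : com) : Prop :=
  exists q q', p = q ++ code o c ++ q' /\ size q = o.

(** A Hoare triple for total correctness within time [T], with a concrete initial store as
    precondition; ranging over all placements makes it compositional. *)
Definition triple (c : com) (T : nat) (r m : store)
    (Q : store -> store -> Prop) : Prop :=
  forall p o, placed p o c -> exists t r' m',
    [/\ t <= T,
        iter t (step p) (State o r m) = State (o + size (code o c)) r' m'
      & Q r' m'].

Lemma triple_conseq c T T' r m (Q Q' : store -> store -> Prop) :
  T <= T' -> (forall r' m', Q r' m' -> Q' r' m') ->
  triple c T r m Q -> triple c T' r m Q'.
Proof.
move=> leT QQ' H p o /H [t [r' [m' [le_t E q]]]].
by exists t, r', m'; split; [apply: leq_trans leT | | apply: QQ'].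
Qed.

Lemma triple_le c T T' r m (Q : store -> store -> Prop) :
  T <= T' -> triple c T r m Q -> triple c T' r m Q.
Proof. by move=> leT; apply: triple_conseq. Qed.

Lemma current_cat q q' a o r m :
  size q = o -> current (q ++ a :: q') (State o r m) = a.
Proof. by move=> <-; rewrite /current nth_cat ltnn subnn. Qed.

Lemma triple_block b r m (Q : store -> store -> Prop) :
  all straight b -> Q (exec b r m).1 (exec b r m).2 ->
  triple (Block b) (size b) r m Q.
Proof.
move=> sb Qb p o [q [q' [-> szq]]]; exists (size b), (exec b r m).1.
exists (exec b r m).2; split=> //=.
elim: b q o r m sb szq {Qb} => [|a b IH] q o r m /=; first by rewrite addn0.
case/andP=> sa sb szq; rewrite -iterS iterSr -cat_rcons.
rewrite {2}/step cat_rcons current_cat // -cat_rcons.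
have {}IH r1 m1 := IH _ _ r1 m1 sb (etrans (size_rcons q a) (congr1 S szq)).
case: a sa IH => [? ?|? ? ?|? ? ?|? ?|? ?|? ?|] // _ IH.
all: by rewrite addnS -addSn -IH.
Qed.

Lemma triple_seq c1 c2 T1 T2 r m (Q : store -> store -> Prop) :
  triple c1 T1 r m (fun r' m' => triple c2 T2 r' m' Q) ->
  triple (Seq c1 c2) (T1 + T2) r m Q.
Proof.
move=> H p o [q [q' [def_p szq]]].
have pl1 : placed p o c1.
  exists q, (code (o + size (code o c1)) c2 ++ q'); split=> //.
  by rewrite def_p /= -!catA.
have pl2 : placed p (o + size (code o c1)) c2.
  exists (q ++ code o c1), q'.
  by split; rewrite ?size_cat ?szq // def_p /= -!catA.
have [t1 [r1 [m1 [le1 E1 H1]]]] := H _ _ pl1.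
have [t2 [r2 [m2 [le2 E2 H2]]]] := H1 _ _ pl2.
exists (t2 + t1), r2, m2; split=> //; first by rewrite addnC leq_add.
by rewrite iterD E1 E2 /= size_cat addnA.
Qed.

(** The invariant is indexed by the turns done. Each turn pays 3 for the test and the jump back, and
    the last test pays 1. *)
Lemma triple_while a c T N r m
    (I : nat -> store -> store -> Prop) (Q : store -> store -> Prop) :
  I 0 r m ->
  (forall j r m, j < N -> I j r m ->
     0 < r a /\ triple c T r m (fun r' m' => I j.+1 (upd r' scratch 0) m')) ->
  (forall r m, I N r m -> r a = 0 /\ Q r m) ->
  triple (While a c) (N * (T + 3) + 1) r m Q.
Proof.
move=> I0 Hbody Hend p o pl; have [q [q' [def_p szq]]] := pl.
have szc : o + size (code o (While a c)) = o + size (code o.+1 c) + 3.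
  by rewrite /= size_cat /=; lia.
have pl1 : placed p o.+1 c.
  exists (rcons q (JumpZ a (o + size (code o.+1 c) + 3))).
  exists ([:: Const scratch 0; JumpZ scratch o] ++ q').
  by split; rewrite ?size_rcons ?szq // def_p /= cat_rcons -catA.
have s0 r0 m0 : step p (State o r0 m0) =
   State (if r0 a == 0 then o + size (code o (While a c)) else o.+1) r0 m0.
  by rewrite szc /step def_p current_cat.
have s1 r0 m0 : iter 2 (step p) (State (o.+1 + size (code o.+1 c)) r0 m0) =
   State o (upd r0 scratch 0) m0.
  have def1 : p = (q ++ JumpZ a (o + size (code o.+1 c) + 3) :: code o.+1 c)
       ++ Const scratch 0 :: JumpZ scratch o :: q'.
    by rewrite def_p /= -?catA /= -?catA.
  have def2 : p = (q ++ JumpZ a (o + size (code o.+1 c) + 3) :: code o.+1 c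
       ++ [:: Const scratch 0]) ++ JumpZ scratch o :: q'.
    by rewrite def_p /= -?catA /= -?catA.
  have -> : iter 2 (step p) (State (o.+1 + size (code o.+1 c)) r0 m0) =
    step p (step p (State (o.+1 + size (code o.+1 c)) r0 m0)) by [].
  have -> : step p (State (o.+1 + size (code o.+1 c)) r0 m0) =
    State (o.+1 + size (code o.+1 c)).+1 (upd r0 scratch 0) m0.
    by rewrite /step def1 current_cat // size_cat /= szq addnS.
  rewrite /step def2 current_cat; first by rewrite /upd eqxx.
  by rewrite size_cat /= size_cat /= szq; lia.
suff main k : forall j r m, j + k = N -> I j r m -> exists t r' m',
    [/\ t <= k * (T + 3) + 1,
      iter t (step p) (State o r m) = State (o + size (code o (While a c))) r' m'
      & Q r' m'].
  exact: (main N 0).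
elim: k => [|k IH] j r1 m1.
  rewrite addn0 => -> /Hend[ra0 Qr].
  exists 1, r1, m1; split=> //.
  by rewrite -[iter 1 _ _]/(step _ _) s0 ra0.
move=> jk Ij; have ltj : j < N by lia.
have [ra /(_ _ _ pl1)[t1 [r2 [m2 [le1 E1 I2]]]]] := Hbody _ _ _ ltj Ij.
have jk' : j.+1 + k = N by lia.
have [t2 [r3 [m3 [le2 E2 Q3]]]] := IH _ _ _ jk' I2.
exists (t2 + (2 + (t1 + 1))), r3, m3; split=> //; first by lia.
rewrite !iterD -[iter 1 _ _]/(step _ _) s0 gtn_eqF // E1.
by rewrite s1 E2.
Qed.

(* The counter [i] runs downwards: the body sees it equal to [r b - 1], ..., 0. *)
Definition For (i b : nat) (c : com) : com :=
  Seq (Block [:: Const scratch 0; Add i b scratch])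
    (While i (Seq (Block [:: Const scratch 1; Defs.Sub i i scratch]) c)).

Definition for_time N T := N * (T + 5) + 3.

(* An invariant of a loop on [i] may not mention the registers that the loop
   control overwrites. *)
Definition ignores (I : store -> store -> Prop) (i : nat) : Prop :=
  forall r r' m, (forall a, a != i -> a != scratch -> r' a = r a) ->
  I r m -> I r' m.

Lemma triple_for i b c T N r m (I : nat -> store -> store -> Prop)
    (Q : store -> store -> Prop) :
  i != scratch -> b != scratch -> r b = N ->
  (forall j, ignores (I j) i) ->
  I N r m ->
  (forall j r m, j < N -> r i = j -> I j.+1 r m ->
     triple c T r m (fun r' m' => r' i = j /\ I j r' m')) ->
  (forall r m, I 0 r m -> Q r m) ->
  triple (For i b c) (for_time N T) r m Q.
Proof.
move=> /negPf niz /negPf nbz rb ign IN Hc HQ.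
apply: (@triple_le _ (2 + (N * ((2 + T) + 3) + 1))).
  by rewrite /for_time; lia.
apply: triple_seq; apply: triple_block => //=.
(* [triple_while] counts turns done, whereas [I] is indexed by turns left. *)
apply: (triple_while (N := N) (I := fun j r m => r i = N - j /\ I (N - j) r m)).
- rewrite subn0 /upd eqxx nbz rb eqxx addn0; split=> //.
  by apply: ign IN => a /negPf ai /negPf az; rewrite /upd ai az.
- move=> j r1 m1 ltj [ri Ij]; split; first by lia.
  apply: triple_seq; apply: triple_block => //=.
  have sj : N - j = (N - j.+1).+1 by lia.
  apply: triple_conseq (leqnn T) _ (Hc (N - j.+1) _ _ _ _ _); last first.
  + by rewrite -sj; apply: ign Ij => a /negPf ai /negPf az; rewrite /upd ai az.
  + by rewrite /upd !eqxx niz ri; lia.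
  + by lia.
  + move=> r2 m2 [ri2 I2]; split; first by rewrite /upd niz.
    by apply: ign I2 => a _ /negPf; rewrite /upd => ->.
- by move=> r1 m1; rewrite subnn => -[ri I0]; split=> //; apply: HQ.
Qed.

(** * Broadcasts as lists of vertices *)

Section Distance.

Variables (V : finType) (e : rel V).

Lemma dist_path u v m :
  dist e u v = Some m ->
  exists2 p, path e u p /\ uniq (u :: p) & last u p = v /\ size p = m.
Proof.
rewrite /dist; case: {-}_ / idP => [uv|//].
case: ex_minnP => m' /existsP[p /and3P[ep up /eqP lp]] _ [<-].
by exists p; rewrite ?size_tuple.
Qed.

Lemma path_dist u p :
  path e u p -> exists2 m, dist e u (last u p) = Some m & m <= size p.
Proof.
move=> ep; have con : connect e u (last u p) by apply/connectP; exists p.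
rewrite /dist; case: {-}_ / idP => [uv|//].
case: ex_minnP => m _ min_m; exists m => //.
(* [dist] minimises over simple paths, so the given path is first made simple. *)
case: (shortenP ep) min_m => q eq uq sub min_m.
apply: leq_trans (min_m (size q) _) _; last first.
  exact: uniq_leq_size (proj2 (andP uq)) sub.
by apply/existsP; exists (in_tuple q); rewrite eq uq /=.
Qed.

Lemma diameter_dist d u v :
  diameter e = Some d -> exists2 m, dist e u v = Some m & m <= d.
Proof.
rewrite /diameter; case: ifP => // /forallP/(_ u)/forallP/(_ v).
case E: (dist e u v) => [m|] // _ [<-]; exists m => //.
apply: leq_trans (leq_bigmax u); apply: leq_trans (leq_bigmax v).
by rewrite E.
Qed.

End Distance.

Section Lists.

Variables (n : nat) (e : rel 'I_n).
Implicit Types s : seq 'I_n.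

(* The numeration with digits 1, ..., n in base n, least significant first: it
   orders lists by length first. *)
Definition list_code s : nat := foldr (fun (v : 'I_n) a => (v + n * a).+1) 0 s.

Lemma size_list_code s : size s <= list_code s.
Proof. by elim: s => //= v s IH; have := ltn_ord v; nia. Qed.

Lemma list_code_lt s : list_code s < n.+1 ^ size s.
Proof. by elim: s => //= v s IH; rewrite expnS; have := ltn_ord v; nia. Qed.

(** Removing the least significant digit from both codes preserves their order, a digit contributing
    less than one unit of the next. *)
Lemma list_code_size s s' : list_code s <= list_code s' -> size s <= size s'.
Proof.
elim: s s' => [|v s IH] [|v' s'] //=; rewrite ltnS => le; apply: IH.
by have := ltn_ord v'; nia.
Qed.

(** This lets a plain counter enumerate the lists. *)
Lemma list_code_surj x : 0 < n -> exists s, list_code s = x.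
Proof.
move=> n0; elim/ltn_ind: x => -[|x] IH; first by exists [::].
have [|s Es] := IH (x %/ n); first by rewrite ltnS leq_div.
exists (Ordinal (ltn_pmod x n0) :: s) => /=.
by rewrite Es addnC mulnC -divn_eq.
Qed.

Definition dominates s : bool :=
  [forall v, exists t,
    (t \in s) && (if dist e t v is Some m then m <= count_mem t s else false)].

Lemma dominatesP s :
  reflect (dominating_broadcast e (fun v => count_mem v s)) (dominates s).
Proof.
apply: (iffP forallP) => H v.
  have /existsP[t /andP[ts]] := H v.
  case E: (dist e t v) => [m|] // le_m; exists t; rewrite -has_count has_pred1.
  by split=> //; exists m.
have [t []] := H v; rewrite -has_count has_pred1 => ts [m E le_m].
by apply/existsP; exists t; rewrite ts E.
Qed.

Lemma list_of_broadcast (f : 'I_n -> nat) :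
  exists2 s, forall v, count_mem v s = f v & size s = broadcast_cost f.
Proof.
exists (flatten [seq nseq (f v) v | v <- enum 'I_n]) => [v|].
  rewrite count_flatten -map_comp sumnE big_map big_enum /=.
  rewrite (bigD1 v) //= count_nseq /= eqxx mul1n big1 ?addn0 // => u /negPf uv.
  by rewrite count_nseq /= uv.
rewrite size_flatten /shape -map_comp sumnE big_map big_enum /=.
by apply: eq_bigr => v _; rewrite /= size_nseq.
Qed.

Lemma broadcast_dominationP k :
  broadcast_domination e k <-> exists2 s, dominates s & size s <= k.
Proof.
split=> [[f [dom_f le_k]] | [s /dominatesP dom_s le_k]].
  have [s Ef sz] := list_of_broadcast f.
  exists s; last by rewrite sz.
  apply/dominatesP => v; have [t Ht] := dom_f v.
  by exists t; rewrite Ef.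
exists (fun v => count_mem v s); split=> //; apply: leq_trans le_k.
rewrite /broadcast_cost eq_leq //; elim: s {dom_s} => [|a s IH] /=.
  by rewrite big1.
rewrite big_split /= IH (bigD1 a) //= eqxx big1 // => v /negPf va.
by rewrite eq_sym va.
Qed.

Lemma diameter_dominates d v :
  diameter e = Some d -> dominates (nseq (maxn d 1) v).
Proof.
move=> diam; apply/dominatesP => u; exists v.
rewrite count_nseq /= eqxx mul1n leq_max orbT; split=> //.
have [m Em le_m] := diameter_dist v u diam.
by exists m; rewrite // leq_max le_m.
Qed.

(** The search stops at this list; its length is optimal since codes order lists by length first. *)
Lemma first_dominating_list d :
  diameter e = Some d ->
  exists s, [/\ dominates s,
    forall s', list_code s' < list_code s -> ~~ dominates s',
    list_code s < n.+1 ^ maxn d 1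
  & forall k, broadcast_domination e k <-> size s <= k].
Proof.
move=> diam.
have [s0 dom0 lt0] : exists2 s, dominates s & list_code s < n.+1 ^ maxn d 1.
  case: (posnP n) => [n0|n0].
    exists [::]; last by rewrite expn_gt0.
    by apply/forallP => v; have := ltn_ord v; rewrite {2}n0.
  exists (nseq (maxn d 1) (Ordinal n0)); first exact: diameter_dominates.
  by apply: leq_trans (list_code_lt _) _; rewrite size_nseq.
(* A list is no longer than its code, so quantifying over bounded lists loses nothing and makes [P]
   decidable. *)
pose P x := [exists s : x.-bseq 'I_n, (list_code s == x) && dominates s].
have PP s : dominates s -> P (list_code s).
  move=> dom_s; apply/existsP; exists (Bseq (size_list_code s)).
  by rewrite /= eqxx.
have [x /existsP[s /andP[/eqP Es dom_s]] min_x] :=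
  ex_minnP (ex_intro P _ (PP _ dom0)).
exists s; split=> //.
- move=> s'; rewrite Es ltnNge; apply: contra => /PP; exact: min_x.
- by rewrite Es; apply: leq_ltn_trans lt0; apply: min_x (PP _ dom0).
move=> k; rewrite broadcast_dominationP; split=> [[s' /PP/min_x le_s]|].
  2: by exists s.
by apply: leq_trans; apply: list_code_size; rewrite Es.
Qed.

End Lists.

(** * The search program *)

Arguments upd f !a x !b /.

(* Registers: 0 holds n, 1 holds k, 2 holds 1, 3 holds n * n, 4 the code of the
   current list, 5 its length, 6 the number of vertices it leaves undominated;
   the others are temporary.  The power of v is in memory cell n * n + v, just
   after the adjacency matrix. *)
Definition clear_cells : com :=
  For 12 0 (Block [:: Add 14 3 12; Const 15 0; Write 14 15]).

(** Repeated subtraction of n: register 9 collects the quotient, 8 ends as the remainder, and 10,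
    equal to r8 + 1 - n, is positive iff n still fits. *)
Definition divide : com :=
  While 10 (Block [:: Defs.Sub 8 8 0; Add 9 9 2; Add 10 8 2; Defs.Sub 10 10 0]).

(* Truncated subtraction makes [x + (1 - x) + 1] equal to 2 for x = 0 and to
   x + 1 otherwise: the power after one more occurrence in the list. *)
Definition decode : com :=
  Seq (Block [:: Const 5 0; Const 7 0; Add 8 4 7])
    (While 8
      (Seq (Block [:: Defs.Sub 8 8 2; Const 9 0; Add 10 8 2; Defs.Sub 10 10 0])
      (Seq divide
        (Block [:: Add 14 3 8; Read 15 14; Defs.Sub 16 2 15; Add 15 15 16;
                   Add 15 15 2; Write 14 15; Add 5 5 2; Const 16 0; Add 8 9 16])))).

(** With truncated subtraction, y + (x - y) is max(x, y). *)
Definition relax : com :=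
  Block [:: Add 18 3 11; Add 19 3 12; Read 16 18; Defs.Sub 16 16 2; Read 17 19;
            Defs.Sub 16 16 17; Add 17 17 16; Write 19 17].

(* Register 14 scans the adjacency matrix backwards.  Its entry, 0 or 1, is the
   number of turns of the innermost loop, which is thus a conditional. *)
Definition relax_all : com :=
  Seq (Block [:: Const 14 0; Add 14 14 3])
    (For 11 0 (For 12 0
      (Seq (Block [:: Defs.Sub 14 14 2; Read 15 14]) (For 10 15 relax)))).

Definition count_zeros : com :=
  Seq (Block [:: Const 6 0])
    (For 12 0 (Block [:: Add 14 3 12; Read 15 14; Defs.Sub 15 2 15; Add 6 6 15])).

Definition test : com :=
  Seq clear_cells (Seq decode (Seq (For 13 0 relax_all) count_zeros)).

(** Setting register 6 to 1 forces the first test, that of the empty list (code 0). The final 1 -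
    (length - k) is 1 iff length <= k. *)
Definition search : com :=
  Seq (Block [:: Const 2 1])
  (Seq (For 12 0 (Block [:: Add 3 3 0]))
  (Seq (Block [:: Const 6 1])
  (Seq (While 6 (Seq test (Block [:: Add 4 4 2])))
    (Block [:: Defs.Sub 5 5 1; Defs.Sub 0 2 5])))).

Ltac block := apply: triple_block; [done | rewrite /=].

(** * Correctness and cost of the search, loop by loop *)

Section Correctness.

Variables (n k : nat) (e : rel 'I_n).
Implicit Types (r m : nat -> nat) (u v : 'I_n) (s : seq 'I_n).

Definition globals (x l : nat) r : Prop :=
  [:: r 0; r 1; r 2; r 3; r 4; r 5] = [:: n; k; 1; n * n; x; l].

Definition adjacency m : Prop := forall u v, m (u * n + v) = e u v.

Definition cell m (v : nat) : nat := m (n * n + v).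

(** Entry (u, w) sits at u * n + w < (u + 1) * n <= n * n, below all power cells. *)
Lemma adjacency_upd m v y : adjacency m -> adjacency (upd m (n * n + v) y).
Proof.
move=> adj u w; rewrite /upd ifN ?adj // neq_ltn.
have : u.+1 * n <= n * n by rewrite leq_mul2r ltn_ord orbT.
by rewrite mulSn; have := ltn_ord w; lia.
Qed.

Lemma cell_upd m v w y :
  cell (upd m (n * n + v) y) w = if w == v :> nat then y else cell m w.
Proof. by rewrite /cell /upd eqn_add2l. Qed.

Lemma clear_cells_triple x l r m :
  globals x l r -> adjacency m ->
  triple clear_cells (for_time n 3) r m (fun r' m' =>
    [/\ globals x l r', adjacency m' & forall v, cell m' v = 0]).
Proof.
move=> G adj.
apply: (triple_for (N := n) (I := fun j r m =>
  [/\ globals x l r, adjacency m & forall v, j <= v -> cell m v = 0])) => //.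
- by case: G.
- by move=> j r1 r2 m1 E []; rewrite /globals !E.
- by split=> // v; rewrite leqNgt ltn_ord.
- move=> j r1 m1 ltj rj [[h0 h1 h2 h3 h4 h5] adj1 z]; block.
  rewrite h3 rj; split=> //; split.
  + by rewrite /globals /= h0 h1 h2 h3 h4 h5.
  + exact: (adjacency_upd (Ordinal ltj)).
  move=> v; rewrite leq_eqVlt (cell_upd _ (Ordinal ltj)) /=.
  by rewrite eq_sym; case: eqP => //= _; exact: z.
by move=> r1 m1 [? ? z]; split=> // v; apply: z.
Qed.

Lemma divide_triple x l a v r m :
  globals x l r -> r 8 = v + n * a -> r 9 = 0 -> r 10 = r 8 + 1 - n ->
  a <= x ->
  triple divide (x * 7 + 1) r m (fun r' m' =>
    [/\ globals x l r', m' = m, r' 8 = v & r' 9 = a]).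
Proof.
move=> G r8 r9 r10 le_a; have ltv := ltn_ord v.
(* The loop makes [a] turns; bounding [a] by [x] gives all divisions of one decoding the same
   cost. *)
apply: (@triple_le _ (a * (4 + 3) + 1)).
  by rewrite leq_add2r leq_mul2r le_a.
apply: (triple_while (N := a) (I := fun j r' m' =>
  [/\ globals x l r', m' = m, r' 8 = v + n * (a - j), r' 9 = j
    & r' 10 = r' 8 + 1 - n])).
- by rewrite subn0.
- move=> j r1 m1 ltj [[h0 h1 h2 h3 h4 h5] -> r81 r91 r101].
  have E : n * (a - j) = n + n * (a - j.+1) by rewrite -mulnS subnSK.
  split; first by rewrite r101 r81 E addn1 subn_gt0 ltnS addnCA leq_addr.
  block; split; rewrite ?h0 ?h2 //.
  + by rewrite /globals /= h0 h1 h2 h3 h4 h5.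
  + by rewrite r81 E addnCA addKn.
  + by rewrite r91 addn1.
move=> r1 m1 [G1 -> r81 r91 r101]; move: r81; rewrite subnn muln0 addn0 => r81.
by split=> //; rewrite r101 r81; lia.
Qed.

(* The shift by 1 keeps a vertex at distance exactly f(t) from t positive. *)
Definition power (s : seq 'I_n) v : nat :=
  count_mem v s + (0 < count_mem v s).

Definition decode_time x := 3 + (x * ((4 + ((x * 7 + 1) + 9)) + 3) + 1).

Lemma decode_triple x l s r m :
  list_code s = x -> globals x l r -> adjacency m -> (forall v, cell m v = 0) ->
  triple decode (decode_time x) r m (fun r' m' =>
    [/\ globals x (size s) r', adjacency m' & forall v, cell m' v = power s v]).
Proof.
move=> Es [h0 h1 h2 h3 h4 h5] adj z.
apply: triple_seq; block.
apply: (@triple_le _ (size s * ((4 + ((x * 7 + 1) + 9)) + 3) + 1)).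
  by rewrite leq_add2r leq_mul2r -Es size_list_code orbT.
(* After [j] turns the first [j] vertices are recorded in the powers and register 8 encodes the
   rest. *)
apply: (triple_while (N := size s) (I := fun j r m =>
  [/\ globals x j r, r 8 = list_code (drop j s), adjacency m
    & forall v, cell m v = power (take j s) v])).
- split; rewrite ?drop0 ?take0 //.
  + by rewrite /globals /= h0 h1 h2 h3 h4.
  + by rewrite /= h4 addn0 Es.
- move=> j r1 m1 ltj [[g0 g1 g2 g3 g4 g5] r8 adj1 c1].
  have [v [Ed Et]] : exists v, drop j s = v :: drop j.+1 s /\
      take j.+1 s = rcons (take j s) v.
    case: s ltj {Es r8 c1} => // v0 s ltj; exists (nth v0 (v0 :: s) j).
    by rewrite (drop_nth v0) // (take_nth v0).
  move: r8; rewrite Ed /= -/(list_code _) => r8; split; first by rewrite r8.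
  apply: triple_seq; block; apply: triple_seq.
  (* The code of a suffix is at most that of the whole list. *)
  have le_a : list_code (drop j.+1 s) <= x.
    rewrite -Es -{2}(cat_take_drop j s) Ed; elim: (take j s) => [|w q IH] /=.
      by have := ltn_ord v; nia.
    by have := ltn_ord w; nia.
  apply: triple_conseq (leqnn _) _ (divide_triple (l := j) (v := v) _ _ _ _ _ le_a);
    first last.
  + rewrite /= ?g0 ?g2 //.
  + by [].
  + by rewrite /= r8 g2 subn1.
  + by rewrite /globals /= g0 g1 g2 g3 g4 g5.
  move=> r2 m2 [[f0 f1 f2 f3 f4 f5] -> r82 r92]; block.
  rewrite f2 f3 r82; split.
  + by rewrite /globals /= f0 f1 f2 f3 f4 f5 addn1.
  + by rewrite /= r92 addn0.
  + exact: adjacency_upd.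
  move=> w; rewrite cell_upd Et /power -cats1 count_cat /= addn0.
  have := c1 v; have := c1 w; rewrite /cell /power => -> ->.
  rewrite -val_eqE eq_sym; case: eqP => [/val_inj->|_] /=; last by rewrite addn0.
  by case: (count_mem w _) => [|c] /=; lia.
move=> r1 m1 []; rewrite drop_size take_size => G1 r8 adj1 c1.
by rewrite r8.
Qed.

(** * Propagation of powers along arcs *)

Section Relaxation.

Variable g : 'I_n -> nat.

(** Soundness: a positive power never exceeds what some initial power retains after losing 1 per arc
    of a path. *)
Definition reachable m : Prop :=
  forall v, 0 < cell m v -> exists t p,
    [/\ path e t p, last t p = v & cell m v + size p <= g t].

(** [D] marks the pairs treated so far in a sweep begun at [m0]. Updates are in place and may carry
    a power over several arcs in one sweep, so only inequalities against [m0] are kept. *)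
Definition relaxed (D : nat -> nat -> bool) m0 m : Prop :=
  [/\ adjacency m, reachable m, forall v, cell m0 v <= cell m v
    & forall u v, e u v -> D u v -> cell m0 u <= cell m v + 1].

Lemma relaxed_sub (D D' : nat -> nat -> bool) m0 m :
  (forall u v, e u v -> D' u v -> D u v) -> relaxed D m0 m -> relaxed D' m0 m.
Proof.
by move=> sub [adj R mono H]; split=> // u v euv /(sub _ _ euv); apply: H.
Qed.

(** Either [v] keeps its power and its witnessing path, or it gets that of [u] minus 1, witnessed by
    the path to [u] extended by the arc. *)
Lemma relaxed_upd D m0 m u v :
  e u v -> relaxed D m0 m ->
  relaxed (fun i j => D i j || (i == u) && (j == v)) m0
    (upd m (n * n + v) (cell m v + (cell m u - 1 - cell m v))).
Proof.
move=> euv [adj R mono H]; split.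
- exact: adjacency_upd.
- move=> w; rewrite cell_upd val_eqE; case: eqP => [-> {w}|_]; last exact: R.
  case: (leqP (cell m u - 1) (cell m v)) => [le|lt] pos.
    have E : cell m v + (cell m u - 1 - cell m v) = cell m v by lia.
    by rewrite E in pos *; apply: R.
  have [|t [p [ep lp le]]] := R u; first by lia.
  exists t, (rcons p v); split.
  + by rewrite rcons_path ep lp.
  + by rewrite last_rcons.
  by rewrite size_rcons; lia.
- by move=> w; rewrite cell_upd val_eqE; have := mono w; case: eqP => [->|]; lia.
move=> i j eij; rewrite cell_upd !val_eqE.
case/orP=> [/(H _ _ eij)|/andP[/eqP iu /eqP jv]].
  by case: (j =P v) => [->|_]; lia.
by rewrite iu jv eqxx; have := mono u; lia.
Qed.

Definition relax_all_time :=
  2 + for_time n (for_time n (2 + for_time 1 8)).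

Lemma relax_all_triple x l i r m :
  globals x l r -> r 13 = i -> adjacency m -> reachable m ->
  triple relax_all relax_all_time r m (fun r' m' =>
    r' 13 = i /\ globals x l r' /\ relaxed (fun _ _ => true) m m').
Proof.
move=> [h0 h1 h2 h3 h4 h5] r13 adj R; apply: triple_seq; block.
apply: (triple_for (N := n) (I := fun j r m' =>
  [/\ globals x l r, r 13 = i, r 14 = j * n
    & relaxed (fun a _ => j <= a) m m'])) => //.
- by move=> j r1 r2 m1 E []; rewrite /globals !E.
- split=> //=; first by rewrite /globals /= h0 h1 h2 h3 h4 h5.
  by split=> // a v _; rewrite leqNgt ltn_ord.
- move=> j r1 m1 ltj r11 [[g0 g1 g2 g3 g4 g5] g13 g14 rel1].
  apply: (triple_for (N := n) (I := fun j' r m' =>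
    [/\ globals x l r, r 13 = i, r 11 = j, r 14 = j * n + j'
      & relaxed (fun a b => (j < a) || (a == j) && (j' <= b)) m m'])) => //.
  + by move=> j' r2 r3 m2 E []; rewrite /globals !E.
  + split=> //; first by rewrite /globals g0 g1 g2 g3 g4 g5.
      by rewrite g14 mulSn addnC.
    apply: relaxed_sub rel1 => a b _ /orP[//|/andP[_]].
    by rewrite leqNgt ltn_ord.
  + move=> j' r2 m2 ltj' r12 [[f0 f1 f2 f3 f4 f5] f13 f11 f14 rel2].
    apply: triple_seq; block.
    pose u := Ordinal ltj; pose v := Ordinal ltj'.
    have Ee : m2 (r2 14 - r2 2) = e u v.
      case: rel2 => adj2 _ _ _; rewrite -adj2 /=; congr m2.
      by rewrite f14 f2; lia.
    apply: (@triple_le _ (for_time (e u v) 8)).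
      by rewrite /for_time; case: (e u v).
    (* At [q = 0] the pair (j, j') counts as treated; if it is not an arc there is no turn and the
       claim about it is vacuous. *)
    apply: (triple_for (N := e u v) (I := fun q r m' =>
      [/\ globals x l r, r 13 = i, r 11 = j /\ r 12 = j', r 14 = j * n + j'
        & relaxed (fun a b => [|| (j < a) || (a == j) && (j'.+1 <= b)
              | [&& a == j, b == j' & q == 0]]) m m'])) => //.
    * by move=> q r3 r4 m3 E [? ? [? ?]]; rewrite /globals !E.
    * split=> //=; last 2 first.
      - by rewrite f14 f2; lia.
      - apply: relaxed_sub rel2 => a b eab /orP[//|/and3P[/eqP aj /eqP bj]].
        have -> : u = a by apply: val_inj.
        have -> : v = b by apply: val_inj.
        by rewrite eab.
      by rewrite /globals /= f0 f1 f2 f3 f4 f5.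
    * move=> q r3 m3 ltq r10 [[d0 d1 d2 d3 d4 d5] d13 [d11 d12] d14 rel3].
      have euv : e u v by case: (e u v) ltq.
      have q0 : q = 0 by case: (e u v) ltq; case: (q).
      block; split=> //; split=> //=.
      - by rewrite /globals /= d0 d1 d2 d3 d4 d5.
      rewrite d2 d3 d11 d12 q0.
      apply: relaxed_sub (relaxed_upd euv rel3) => a b _ /=.
      by rewrite q0 !andbF orbF andbT.
    move=> r3 m3 [? ? [? ?] ? rel3]; split=> //; split=> //.
    apply: relaxed_sub rel3 => a b _ /=; rewrite andbT.
    by rewrite (leq_eqVlt j') (eq_sym j') -orbA -andb_orr [(j' < b) || _]orbC.
  move=> r2 m2 [? ? ? E H2]; split=> //; split=> //; first by rewrite E addn0.
  apply: relaxed_sub H2 => a b _ lt_a; rewrite leq0n andbT.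
  by rewrite leq_eqVlt eq_sym orbC in lt_a.
move=> r1 m1 [? ? ? rel1]; split=> //; split=> //.
Qed.

(** Completeness after [i] sweeps, in additive form to avoid truncated subtraction. *)
Definition lower i m : Prop :=
  forall t p, path e t p -> size p <= i -> g t <= cell m (last t p) + size p.

(** As in Bellman-Ford: earlier sweeps handle the path without its last arc, and the new sweep
    relaxes that arc. *)
Lemma lower_relaxed i m0 m :
  lower i m0 -> relaxed (fun _ _ => true) m0 m -> lower i.+1 m.
Proof.
move=> low [_ _ mono H] t p; case/lastP: p => [|p v] ep.
  by move=> _; apply: leq_trans (low t [::] ep _) _; rewrite // leq_add2r mono.
rewrite last_rcons size_rcons ltnS => le_p; move: ep.
rewrite rcons_path => /andP[ep euv].
have := low _ _ ep le_p; have := H _ _ euv isT; lia.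
Qed.

Definition relaxation_time := for_time n relax_all_time.

Lemma relaxation_triple x l r m :
  globals x l r -> adjacency m -> (forall v, cell m v = g v) ->
  triple (For 13 0 relax_all) relaxation_time r m (fun r' m' =>
    [/\ globals x l r', adjacency m', reachable m' & lower n m']).
Proof.
move=> G adj Eg.
apply: (triple_for (N := n) (I := fun j r m =>
  [/\ globals x l r, adjacency m, reachable m & lower (n - j) m])) => //.
- by case: G.
- by move=> j r1 r2 m1 E []; rewrite /globals !E.
- split=> //; first by move=> v _; exists v, [::]; rewrite Eg addn0.
  by move=> t p _; rewrite subnn leqn0 => /nilP->; rewrite Eg addn0.
- move=> j r1 m1 ltj rj [G1 adj1 R1 low1].
  apply: triple_conseq (leqnn _) _ (relax_all_triple G1 rj adj1 R1).
  move=> r2 m2 [-> [G2 rel2]]; split=> //; split=> //; try by case: rel2.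
  by rewrite -subnSK //; apply: lower_relaxed rel2.
by move=> r1 m1 []; rewrite subn0.
Qed.

End Relaxation.

(** A listed t starts at f(t) + 1, so power remains at v iff some path from a listed t to v has at
    most f(t) arcs. *)
Lemma reachable_lower_dominates s m :
  reachable (power s) m -> lower (power s) n m ->
  (forall v, 0 < cell m v) <-> dominates e s.
Proof.
move=> R low; split=> [pos|/forallP dom v].
  apply/forallP=> v; have [t [p [ep lp le]]] := R v (pos v).
  have := pos v; move: le; rewrite /power => le pos_v.
  have [m' Em le_m] := path_dist ep; apply/existsP; exists t.
  rewrite -lp Em -has_pred1 has_count; move: le.
  have {}le_m : m' <= size p := le_m.
  by case: (count_mem t s) => [|c] /=; lia.
have /existsP[t /andP[ts]] := dom v; case E: (dist e t v) => [d|] // le_d.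
have [p [ep up] [lp sz]] := dist_path E.
(* A shortest path is simple, so [n] sweeps reach its end. *)
have le_p : size p <= n.
  have := uniq_leq_size up (fun a _ => mem_enum 'I_n a).
  by rewrite size_enum_ord => /ltnW.
have := low _ _ ep le_p; rewrite lp sz /power -has_count has_pred1 ts.
move/leq_trans=> /(_ _ (leq_add (leqnn _) le_d)).
by rewrite addnC leq_add2r.
Qed.

Definition count_zeros_time := 1 + for_time n 4.

Lemma count_zeros_triple x l r m :
  globals x l r -> adjacency m ->
  triple count_zeros count_zeros_time r m (fun r' m' =>
    [/\ globals x l r', adjacency m' & r' 6 = 0 <-> forall v, 0 < cell m v]).
Proof.
move=> [h0 h1 h2 h3 h4 h5] adj; apply: triple_seq; block.
apply: (triple_for (N := n) (I := fun j r m' =>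
  [/\ globals x l r, m' = m & r 6 = 0 <-> forall v, j <= v -> 0 < cell m v])) => //.
- by move=> j r1 r2 m1 E []; rewrite /globals !E.
- split=> //; first by rewrite /globals /= h0 h1 h2 h3 h4 h5.
  by split=> // _ v; rewrite leqNgt ltn_ord.
- move=> j r1 m1 ltj rj [[g0 g1 g2 g3 g4 g5] -> H]; block; split=> //; split=> //.
    by rewrite /globals /= g0 g1 g2 g3 g4 g5.
  rewrite g2 g3 rj -/(cell m j); split=> [E v|pos].
    have E6 : r1 6 = 0 by lia.
    rewrite leq_eqVlt => /orP[/eqP<-|]; first by lia.
    by move: v; apply/H.
  have := pos (Ordinal ltj) (leqnn _); rewrite /= => pos_j.
  have -> : r1 6 = 0 by apply/H => v /ltnW; apply: pos.
  by lia.
move=> r1 m1 [G1 -> H]; split=> //; apply: iff_trans H _.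
by split=> pos v *; apply: pos.
Qed.

Definition test_time x :=
  for_time n 3 + (decode_time x + (relaxation_time + count_zeros_time)).

Lemma test_triple x l s r m :
  list_code s = x -> globals x l r -> adjacency m ->
  triple test (test_time x) r m (fun r' m' =>
    [/\ globals x (size s) r', adjacency m' & r' 6 = 0 <-> dominates e s]).
Proof.
move=> Es G adj; apply: triple_seq.
apply: triple_conseq (leqnn _) _ (clear_cells_triple G adj).
move=> r1 m1 [G1 adj1 z1]; apply: triple_seq.
apply: triple_conseq (leqnn _) _ (decode_triple Es G1 adj1 z1).
move=> r2 m2 [G2 adj2 E2]; apply: triple_seq.
apply: triple_conseq (leqnn _) _ (relaxation_triple G2 adj2 E2).
move=> r3 m3 [G3 adj3 R3 low3].
apply: triple_conseq (leqnn _) _ (count_zeros_triple G3 adj3).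
move=> r4 m4 [G4 adj4 H]; split=> //; apply: iff_trans H _.
exact: reachable_lower_dominates R3 low3.
Qed.

(** Codes 0, ..., x are tested, each charged the cost of the largest. *)
Definition search_time x :=
  1 + (for_time n 1 + (1 + ((x.+1 * ((test_time x + 1) + 3) + 1) + 2))).

Lemma test_time_mono x y : x <= y -> test_time x <= test_time y.
Proof. by move=> le; rewrite /test_time /decode_time; nia. Qed.

Lemma search_triple s r m :
  [:: r 0; r 1; r 3; r 4; r 5] = [:: n; k; 0; 0; 0] -> adjacency m ->
  dominates e s ->
  (forall s', list_code s' < list_code s -> ~~ dominates e s') ->
  triple search (search_time (list_code s)) r m (fun r' _ =>
    r' 0 = 1 <-> size s <= k).
Proof.
move=> [h0 h1 h3 h4 h5] adj dom_s min_s; apply: triple_seq; block.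
apply: triple_seq.
apply: (triple_for (N := n) (I := fun j r m' =>
  [:: r 0; r 1; r 2; r 3; r 4; r 5] = [:: n; k; 1; (n - j) * n; 0; 0] /\
  m' = m)) => //.
- by move=> j r1 r2 m1 E []; rewrite !E.
- by rewrite /= h0 h1 h3 h4 h5 subnn.
- move=> j r1 m1 ltj rj [[g0 g1 g2 g3 g4 g5] ->]; block; split=> //; split=> //.
  by rewrite g0 g1 g2 g3 g4 g5 -(subnSK ltj) mulSn addnC.
move=> r1 m1 []; rewrite subn0 => G1 ->; apply: triple_seq; block; apply: triple_seq.
apply: (triple_while (N := (list_code s).+1) (I := fun j r m =>
  [/\ exists l, globals j l r, adjacency m, j <= list_code s -> 0 < r 6
   & list_code s < j -> r 5 = size s /\ r 6 = 0])).
- split=> //; exists 0; case: G1 => g0 g1 g2 g3 g4 g5.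
  by rewrite /globals /= g0 g1 g2 g3 g4 g5.
- move=> j r2 m2; rewrite ltnS => le_j [[l G2] adj2 pos _]; split; first exact: pos.
  (* At the code of [s] the list under test is taken to be [s] itself; at a smaller code any list
     with that code fails by minimality. *)
  have [s' Es' H] : exists2 s', list_code s' = j &
      if j == list_code s then s' = s else ~~ dominates e s'.
    case: eqP => [->|/eqP ne]; first by exists s.
    have ltj : j < list_code s by rewrite ltn_neqAle ne.
    (* A code below that of [s] makes [s] nonempty, which supplies a vertex. *)
    have n0 : 0 < n by case: (s) ltj => // v _ _; apply: leq_ltn_trans (ltn_ord v).
    have [s' Es'] := list_code_surj j n0; exists s' => //.
    by apply: min_s; rewrite Es'.
  apply: triple_seq.
  apply: triple_conseq (test_time_mono le_j) _ (test_triple Es' G2 adj2).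
  move=> r3 m3 [[g0 g1 g2 g3 g4 g5] adj3 flag]; block; split=> //.
  + by exists (size s'); rewrite /globals /= g0 g1 g2 g3 g4 g5 addn1.
  + rewrite ltn_neqAle => /andP[/negPf ne _]; rewrite ne in H.
    by rewrite lt0n; apply: contra H => /eqP/flag.
  rewrite ltnS => ge_j; have E : j = list_code s by apply/eqP; rewrite eqn_leq le_j.
  move: H; rewrite E eqxx => Hs; rewrite g5 Hs; split=> //.
  by apply/flag; rewrite Hs.
move=> r2 m2 [[l [g0 g1 g2 g3 g4 g5]] _ _ /(_ (leqnn _))[r5 r6]]; split=> //; block.
by rewrite g1 g2 r5; lia.
Qed.

End Correctness.

(** * Running time *)

(** Execution runs off the end of the code, which reads as [Halt], and the state then stays fixed
    until time [T]. *)
Lemma triple_decides c T r m (Q : Prop) :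
  triple c T r m (fun r' _ => r' 0 = 1 <-> Q) ->
  decides_within (code 0 c) (State 0 r m) Q T.
Proof.
have pl : placed (code 0 c) 0 c by exists [::], [::]; rewrite cats0.
move=> /(_ _ _ pl)[t [r' [m' [le_t E HQ]]]]; rewrite /decides_within.
have halt : current (code 0 c) (State (0 + size (code 0 c)) r' m') = Halt.
  exact: nth_default.
rewrite -(subnK le_t) iterD E iter_fix; first by rewrite /halted halt.
by rewrite /step halt.
Qed.

Lemma diameter_eq0 (V : finType) (e : rel V) d :
  #|V| <= 1 -> diameter e = Some d -> d = 0.
Proof.
move=> V1; rewrite /diameter; case: ifP => // _ [<-].
apply: big1 => u _; apply: big1 => v _.
have -> : v = u by apply: (fintype_le1P V1).
by have [m /= -> ] := path_dist (isT : path e u [::]); case: m.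
Qed.

Lemma diameter_gt0 (V : finType) (e : rel V) d :
  1 < #|V| -> diameter e = Some d -> 0 < d.
Proof.
case/card_gt1P=> u [v [_ _ uv]] /(diameter_dist u v)[m Em].
apply: leq_trans; rewrite lt0n; apply: contra uv => /eqP m0.
have [p _ [<- sz_p]] := dist_path Em.
by move: sz_p; rewrite m0 => /size0nil->.
Qed.

(** A sweep costs O(w^2), so the at most w sweeps of a test cost O(w^3), decoding only O(w^2); there
    are at most w tests. *)
Lemma search_time_le n x w : n <= w -> x < w -> search_time n x <= 200 * w ^ 4.
Proof.
move=> le_n lt_x; have w0 : 0 < w by apply: leq_trans lt_x.
have Hr : relax_all_time n <= 40 * w ^ 2 by rewrite /relax_all_time /for_time; nia.
have Hrs : relaxation_time n <= 50 * w ^ 3.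
  by rewrite /relaxation_time /for_time; nia.
have Ht : test_time n x <= 120 * w ^ 3.
  by rewrite /test_time /decode_time /count_zeros_time /for_time; nia.
rewrite /search_time /for_time; nia.
Qed.

(** Euclidean division by [n] recovers row and column from an address. *)
Lemma adjacency_instance n (e : rel 'I_n) k : adjacency e (Defs.mem (instance e k)).
Proof.
move=> u v /=; congr nat_of_bool; apply/existsP/idP => [[i /existsP[j]]|euv].
  case/andP=> /eqP E; suff [-> ->] : u = i /\ v = j by [].
  have n0 : 0 < n by apply: leq_ltn_trans (ltn_ord u).
  split; apply: ord_inj.
    by have := congr1 (divn^~ n) E; rewrite !divnMDl // !divn_small ?addn0.
  by have := congr1 (modn^~ n) E; rewrite !modnMDl !modn_small.
by exists u; apply/existsP; exists v; rewrite eqxx.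
Qed.

Lemma power_time_le (a b d n : nat) :
  0 < b -> 0 < d -> 0 < n ->
  a * (n ^ (2 * d)) ^ 4 <= a * b * (d ^ d * n ^ (8 * d)).
Proof.
move=> b0 d0 n0; rewrite -mulnA leq_mul2l -expnM; apply/orP; right.
have -> : 2 * d * 4 = 8 * d by lia.
by rewrite mulnA leq_pmull // muln_gt0 expn_gt0 b0 d0.
Qed.

Theorem theorem7 :
  exists (p : program) (C c : nat),
    forall (n : nat) (e : rel 'I_n) (d k : nat),
      weakly_connected e ->
      diameter e = Some d ->
      decides_within p (instance e k) (broadcast_domination e k)
        (C * (d ^ d * n ^ (c * d))).
Proof.
(* For n >= 2 take w = n^(2d), whose fourth power gives the exponent 8; for n <= 1 take w = 2,
   whence the factor 2^4. *)
exists (code 0 search), (200 * 2 ^ 4), 8 => n e d k _ diam.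
have [s [dom_s min_s lt_s sizeP]] := first_dominating_list diam.
apply: triple_decides.
apply: triple_conseq (search_triple (k := k) _ _ dom_s min_s) => //; last first.
- exact: adjacency_instance.
- by move=> r' _ H; apply: iff_trans H _; apply: iff_sym.
case: (leqP n 1) => [le1|gt1].
  (* Here 0^0 = n^0 = 1, so the time bound is the constant alone. *)
  have d0 : d = 0 by apply: diameter_eq0 diam; rewrite card_ord.
  rewrite d0 in lt_s *; rewrite !muln1.
  apply: search_time_le; first exact: leq_trans le1 _.
  by apply: leq_trans lt_s _; rewrite max0n expn1.
have d_gt0 : 0 < d by apply: diameter_gt0 diam; rewrite card_ord.
apply: leq_trans (search_time_le (w := n ^ (2 * d)) _ _) _.
- by rewrite -{1}(expn1 n) leq_exp2l // muln_gt0.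
(* n + 1 <= n^2 because n >= 2. *)
- apply: leq_trans lt_s _; rewrite (maxn_idPl d_gt0) expnM leq_exp2r //.
  by nia.
by apply: power_time_le => //; apply: ltnW.
Qed.
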